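(* Let $(\Omega,\mathscr{H},\widehat{E})$ be a sub-linear expectation space with conjugate expectation $\widehat{\mathcal{E}}$ and upper capacity $\mathbb{V}$. Let $\{X_n;n\geq1\}\subset\mathscr{H}$ be a sequence of independent and identically distributed random variables in $(\Omega,\mathscr{H},\widehat{E})$, put $S_n=\sum_{i=1}^nX_i$, and suppose $\mathbb{V}$ is countably sub-additive. (1) Let $0<p<1$. If $C_{\mathbb{V}}(|X_1|^p)<\infty$, then $S_n/n^{1/p}\to 0$ a.s. $\mathbb{V}$ as $n\to\infty$. (2) Let $1<p<2$. Suppose that $\widehat{E}[X_n]=\widehat{\mathcal{E}}[X_n]=\mu$ for all $n$ (with $\mu\in\mathbb{R}$) and $\lim_{a\to\infty}\widehat{E}\left[(|X_1|-a)^+\right]=0$. If $C_{\mathbb{V}}(|X_1|^p)<\infty$, then $(S_n-n\mu)/n^{1/p}\to 0$ a.s. $\mathbb{V}$ as $n\to\infty$.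
   Context: Let $(\Omega,\mathcal{F})$ be a measurable space and let $\mathscr{H}$ be a linear space of real ($\mathcal{F}$-measurable) functions on $\Omega$ such that $X_1,\ldots,X_n\in\mathscr{H}$ implies $\varphi(X_1,\ldots,X_n)\in\mathscr{H}$ for every $\varphi\in C_{l,Lip}(\mathbb{R}^n)$. Here $C_{l,Lip}(\mathbb{R}^n)$ is the linear space of functions $\varphi:\mathbb{R}^n\to\mathbb{R}$ satisfying $|\varphi(x)-\varphi(y)|\leq C(1+|x|^m+|y|^m)|x-y|$ for all $x,y\in\mathbb{R}^n$, for some $C>0$ and $m\in\mathbb{N}$ depending on $\varphi$. Elements of $\mathscr{H}$ are called random variables. A sub-linear expectation on $\mathscr{H}$ is a function $\widehat{E}:\mathscr{H}\to[-\infty,+\infty]$ such that for all $X,Y\in\mathscr{H}$: (a) $X\geq Y$ implies $\widehat{E}[X]\geq\widehat{E}[Y]$; (b) $\widehat{E}[c]=c$ for constants $c$; (c) $\widehat{E}[X+Y]\leq\widehat{E}[X]+\widehat{E}[Y]$ whenever the right-hand side is not of the form $+\infty-\infty$ or $-\infty+\infty$; (d) $\widehat{E}[\lambda X]=\lambda\widehat{E}[X]$ for $\lambda\geq 0$. The triple $(\Omega,\mathscr{H},\widehat{E})$ is called a sub-linear expectation space. The conjugate expectation is $\widehat{\mathcal{E}}[X]:=-\widehat{E}[-X]$. The upper capacity generated by $\widehat{E}$ is $\mathbb{V}(A):=\inf\{\widehat{E}[\xi]: I_A\leq\xi,\ \xi\in\mathscr{H}\}$ for $A\in\mathcal{F}$,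 where $I_A$ is the indicator function of $A$. $\mathbb{V}$ is called countably sub-additive if $\mathbb{V}(\bigcup_{n=1}^{\infty}A_n)\leq\sum_{n=1}^{\infty}\mathbb{V}(A_n)$ for all $A_n\in\mathcal{F}$. A property holds a.s. $\mathbb{V}$ (almost surely in capacity) if the set $N\in\mathcal{F}$ where it fails satisfies $\mathbb{V}(N)=0$. The Choquet integral is $C_{\mathbb{V}}(X)=\int_0^{\infty}\mathbb{V}(X\geq t)\,dt+\int_{-\infty}^0[\mathbb{V}(X\geq t)-1]\,dt$; in particular for $X\geq0$ it equals $\int_0^\infty\mathbb{V}(X\geq t)\,dt$. Identical distribution: random variables $X$ and $Y$ in $\mathscr{H}$ are identically distributed if $\widehat{E}[\varphi(X)]=\widehat{E}[\varphi(Y)]$ for all $\varphi\in C_{l,Lip}(\mathbb{R})$ whenever the sub-linear expectations are finite; a sequence $\{X_n;n\geq1\}$ is identically distributed if each $X_i$ is identically distributed with $X_1$. Independence: a random vector $\mathbf{Y}=(Y_1,\ldots,Y_n)$ ($Y_i\in\mathscr{H}$) is independent to a random vector $\mathbf{X}=(X_1,\ldots,X_m)$ ($X_i\in\mathscr{H}$) under $\widehat{E}$ if for each $\varphi\in C_{l,Lip}(\mathbb{R}^m\times\mathbb{R}^n)$ one has $\widehat{E}[\varphi(\mathbf{X},\mathbf{Y})]=\widehat{E}\big[\widehat{E}[\varphi(\mathbf{x},\mathbf{Y})]|_{\mathbf{x}=\mathbf{X}}\big]$ whenever $\overline{\varphi}(\mathbf{x}):=\widehat{E}[\varphi(\mathbf{x},\mathbf{Y})]<\infty$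 for all $\mathbf{x}$ and $\widehat{E}[|\overline{\varphi}(\mathbf{X})|]<\infty$. A sequence $\{X_n;n\geq1\}$ of random variables is independent if $X_{i+1}$ is independent to $(X_1,\ldots,X_i)$ for each $i\geq 1$. *)

(* Defs.v *)
From HB Require Import structures.
From mathcomp Require Export all_boot all_order all_algebra.
From mathcomp Require Export all_classical all_reals all_analysis.

Set Implicit Arguments.
Unset Strict Implicit.
Unset Printing Implicit Defensive.

Import Order.TTheory GRing.Theory Num.Theory.
Import numFieldNormedType.Exports.

Local Open Scope classical_set_scope.
Local Open Scope ring_scope.

(* The canonical norm of ['rV[R]_n] in the library is the max norm. *)
Definition euclidean_norm (R : realType) (n : nat) (x : 'rV[R]_n) : R :=
  Num.sqrt (\sum_(i < n) x ord0 i ^+ 2).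

Definition C_lLip (R : realType) (n : nat) (phi : 'rV[R]_n -> R) : Prop :=
  exists (C : R) (m : nat), 0 < C /\ forall x y : 'rV[R]_n,
    `|phi x - phi y| <=
      C * (1 + euclidean_norm x ^+ m + euclidean_norm y ^+ m)
        * euclidean_norm (x - y).

Definition random_vector (R : realType) (T : Type) (n : nat)
    (X : 'I_n -> T -> R) (w : T) : 'rV[R]_n :=
  \row_(i < n) X i w.

Record random_variable_space (R : realType) (d : measure_display)
    (T : measurableType d) (H : set (T -> R)) : Prop := {
  rvs_measurable : forall X, H X -> measurable_fun setT X;
  rvs_zero : H (fun _ => 0);
  rvs_add : forall X Y, H X -> H Y -> H (fun w => X w + Y w);
  rvs_scale : forall (c : R) X, H X -> H (fun w => c * X w);
  rvs_comp : forall (n : nat) (X : 'I_n -> T -> R) (phi : 'rV[R]_n -> R),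
    (forall i, H (X i)) -> C_lLip phi ->
    H (fun w => phi (random_vector X w))
}.

(* The functional is represented by a total function; its values outside [H]
   are unconstrained, and all the definitions below only use it on [H]. *)
Record sublinear_expectation (R : realType) (T : Type) (H : set (T -> R))
    (E : (T -> R) -> \bar R) : Prop := {
  sle_monotone : forall X Y, H X -> H Y -> (forall w, Y w <= X w) ->
    (E Y <= E X)%E;
  sle_cst : forall c : R, E (fun _ => c) = c%:E;
  sle_subadditive : forall X Y, H X -> H Y -> (E X +? E Y)%E ->
    (E (fun w => X w + Y w)%R <= E X + E Y)%E;
  sle_homogeneous : forall (lambda : R) X, H X -> 0 <= lambda ->
    E (fun w => lambda * X w) = (lambda%:E * E X)%E
}.

Definition conjugate_expectation (R : realType) (T : Type)
    (E : (T -> R) -> \bar R) (X : T -> R) : \bar R :=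
  (- E (fun w => - X w)%R)%E.

Definition upper_capacity (R : realType) (T : Type) (H : set (T -> R))
    (E : (T -> R) -> \bar R) (A : set T) : \bar R :=
  ereal_inf [set E xi | xi in [set xi | H xi /\ forall w, \1_A w <= xi w]].

Definition countably_subadditive (R : realType) (d : measure_display)
    (T : measurableType d) (V : set T -> \bar R) : Prop :=
  forall A : nat -> set T, (forall n, measurable (A n)) ->
    (V (\bigcup_n A n) <= \sum_(0 <= n <oo) V (A n))%E.

Definition almost_surely (R : realType) (d : measure_display)
    (T : measurableType d) (V : set T -> \bar R) (P : T -> Prop) : Prop :=
  measurable [set w | ~ P w] /\ V [set w | ~ P w] = 0%E.

Definition choquet_integral (R : realType) (T : Type) (V : set T -> \bar R)
    (X : T -> R) : \bar R :=
  (\int[@lebesgue_measure R]_(t in `[0%R, +oo[) V [set w | (t <= X w)%R] +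
   \int[@lebesgue_measure R]_(t in `]-oo, 0%R])
      (V [set w | (t <= X w)%R] - 1))%E.

Definition identically_distributed (R : realType) (T : Type)
    (E : (T -> R) -> \bar R) (X Y : T -> R) : Prop :=
  forall phi : 'rV[R]_1 -> R, C_lLip phi ->
    let phiX w := phi (random_vector (fun _ : 'I_1 => X) w) in
    let phiY w := phi (random_vector (fun _ : 'I_1 => Y) w) in
    E phiX \is a fin_num -> E phiY \is a fin_num -> E phiX = E phiY.

(* "Y is independent to X": [Z] is the function [phibar(X)], which has to be a
   random variable, i.e. real-valued and in [H], for its expectation to be
   meaningful. *)
Definition independent_to (R : realType) (T : Type) (H : set (T -> R))
    (E : (T -> R) -> \bar R) (m n : nat)
    (Y : 'I_n -> T -> R) (X : 'I_m -> T -> R) : Prop :=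
  forall phi : 'rV[R]_(m + n) -> R, C_lLip phi ->
    let phibar (x : 'rV[R]_m) : \bar R :=
      E (fun w => phi (row_mx x (random_vector Y w))) in
    (forall x, (phibar x < +oo)%E) ->
    forall Z : T -> R, H Z ->
      (forall w, phibar (random_vector X w) = (Z w)%:E) ->
      (E (fun w => `|Z w|)%R < +oo)%E ->
      E (fun w => phi (row_mx (random_vector X w) (random_vector Y w))) = E Z.

(* Sequences are indexed from 0: [X k] is the (k+1)-st variable. *)
Definition iid_sequence (R : realType) (T : Type) (H : set (T -> R))
    (E : (T -> R) -> \bar R) (X : nat -> T -> R) : Prop :=
  (forall i, independent_to H E
     (fun _ : 'I_1 => X i.+1) (fun j : 'I_i.+1 => X j)) /\
  (forall i, identically_distributed E (X i) (X 0%N)).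

Definition partial_sum (R : realType) (T : Type) (X : nat -> T -> R) (n : nat)
    (w : T) : R :=
  \sum_(i < n) X i w.

(* Main.v *)
Require Import Defs.
From mathcomp Require Import measurable_realfun.
From mathcomp Require Import ring lra.
Import Order.TTheory GRing.Theory Num.Theory.
Import numFieldNormedType.Exports.

Set Implicit Arguments.
Unset Strict Implicit.
Unset Printing Implicit Defensive.

Local Open Scope classical_set_scope.
Local Open Scope ring_scope.

(** Fix b = 2^(1/p), so that b^i is the normalisation n^(1/p) at n = 2^i; it is
enough to control S_n uniformly over each dyadic block 2^i <= n < 2^(i+1), up
to o(b^i).

Everything known about the law of X_0 is condensed into the numbers
V(|X_0| >= b^j).  Since {|X_0| >= b^j} = {|X_0|^p >= 2^j}, finiteness of the
Choquet integral says, by Cauchy condensation, that the sum of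
2^j V(|X_0| >= b^j) is finite ([choquet_tails]).  A pointwise bound by functions
that dominate tail indicators passes to E by monotonicity and sub-additivity,
and in this way the tails yield two estimates:
- if b^q > 2, then 2^i E[min(|X_0| / b^i, 1)^q] is summable in i
  ([capped_moments]); this applies with q = 1 when p < 1 and q = 2 when p < 2;
- if 1 < b <= 2, the excess E[(|X_0| - b^i)^+] is o((b/2)^i)
  ([mean_excess_le]); bounding it by infinitely many tails would require
  countable sub-additivity of E; instead, finitely many tails are used, and the
  remainder vanishes because E[(|X_0| - a)^+] tends to 0.

Random variables zeta_i >= 0 with summable upper expectations tend to 0 off a
set of capacity 0 ([borel_cantelli_cvg0]): this is Borel--Cantelli combined with
the Markov inequality, and it is where countable sub-additivity of V enters.
Both parts then consist in finding zeta_i that dominates the i-th block.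

For p < 1, zeta_i is the sum over k < 2^(i+1) of min(|X_k| / b^i, 1).  When it
is less than 1 no truncation takes place, and |S_n| <= b^i zeta_i on the block.

For p > 1 the fluctuations of the truncated sums have to be estimated
uniformly over a block.  The maximal inequality comes from the reflected
(Lindley) walk W_(n+1) = max (W_n + f(X_n), 0), which dominates all sums of
f(X_k) over final segments of {0, ..., n-1}.  As W_n >= 0, independence and
positive homogeneity give E[W_n f(X_n)] <= 0 whenever E[f(X_0)] <= 0, hence
E[W_n^2] <= n E[f(X_0)^2] ([mean_lindley_sqr]).  With f the clipped variable
minus mu, respectively its opposite, lowered by the excess so that E[f] <= 0,
two such walks bound the centred sums from both sides
([partial_sum_le_lindley]).  The existence of a common mean
E[X] = - E[-X] = mu is what makes both signs available.  Then zeta_i is the sum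
of min(|X_k| / b^i, 1)^2 over the block plus the squares of the two walks over
b^(2i). *)

(** * Lipschitz functions and closure of the space of random variables *)

Definition lipschitz_with (R : realType) (L : R) (f : R -> R) : Prop :=
  forall x y, `|f x - f y| <= L * `|x - y|.

Section local_lipschitz.
Context {R : realType}.
Implicit Types (f g : R -> R) (L B c : R).

Lemma euclidean_norm_ge0 n (x : 'rV[R]_n) : 0 <= euclidean_norm x.
Proof. exact: sqrtr_ge0. Qed.

Lemma coord_le_euclidean_norm n (x : 'rV[R]_n) i :
  `|x ord0 i| <= euclidean_norm x.
Proof.
rewrite -sqrtr_sqr ler_wsqrtr// (bigD1 i)//= lerDl.
by apply: sumr_ge0 => j _; exact: sqr_ge0.
Qed.

(** The l^1 form of the increment is the one produced by Lipschitz functions of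
finitely many coordinates; it is at most n times the Euclidean distance. *)
Lemma C_lLip_lipschitz n (phi : 'rV[R]_n -> R) L : 0 <= L ->
  (forall x y, `|phi x - phi y| <=
               L * \sum_(i < n) `|x ord0 i - y ord0 i|) ->
  C_lLip phi.
Proof.
move=> L0 phiL; exists (L * n%:R + 1), 0%N; split.
  by rewrite ltr_wpDl// mulr_ge0.
move=> x y; apply: le_trans (phiL x y) _.
have N0 := euclidean_norm_ge0 (x - y).
have Ln0 : 0 <= L * n%:R by rewrite mulr_ge0.
have : \sum_(i < n) `|x ord0 i - y ord0 i| <= n%:R * euclidean_norm (x - y).
  apply: le_trans (_ : _ <= \sum_(i < n) euclidean_norm (x - y)) _.
    apply: ler_sum => i _.
    by have := coord_le_euclidean_norm (x - y) i; rewrite !mxE.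
  by rewrite sumr_const card_ord mulr_natl.
move=> /(ler_wpM2l L0) /le_trans; apply; rewrite !expr0.
by rewrite mulrA ler_wpM2r//; lra.
Qed.

(** Linear growth of the local Lipschitz constant is allowed so that squaring is
covered. *)
Lemma C_lLip_uni g c : 0 <= c ->
  (forall x y, `|g x - g y| <= c * (1 + `|x| + `|y|) * `|x - y|) ->
  C_lLip (fun z : 'rV[R]_1 => g (z ord0 ord0)).
Proof.
move=> c0 gc; exists (c + 1), 1%N; split; first by lra.
move=> x y; apply: le_trans (gc _ _) _; rewrite !expr1.
have xN := coord_le_euclidean_norm x ord0.
have yN := coord_le_euclidean_norm y ord0.
have xyN := coord_le_euclidean_norm (x - y) ord0; rewrite !mxE in xyN.
have [x0 y0] := (normr_ge0 (x ord0 ord0), normr_ge0 (y ord0 ord0)).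
apply: ler_pM => //; first by rewrite mulr_ge0// !addr_ge0.
by apply: ler_pM => //; lra.
Qed.

Lemma lipschitz_local g L : 0 <= L -> lipschitz_with L g ->
  forall x y, `|g x - g y| <= L * (1 + `|x| + `|y|) * `|x - y|.
Proof.
move=> L0 gL x y; apply: le_trans (gL x y) _; rewrite ler_wpM2r//.
by rewrite ler_peMr// -addrA lerDl addr_ge0.
Qed.

Lemma dist_maxr (a b c : R) : `|Num.max a c - Num.max b c| <= `|a - b|.
Proof.
rewrite ler_norml; have := ler_norm (a - b); have := ler_norm (b - a).
by rewrite (distrC b a); case: (leP a c); case: (leP b c); lra.
Qed.

Lemma dist_minr (a b c : R) : `|Num.min a c - Num.min b c| <= `|a - b|.
Proof.
rewrite ler_norml; have := ler_norm (a - b); have := ler_norm (b - a).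
by rewrite (distrC b a); case: (leP a c); case: (leP b c); lra.
Qed.

End local_lipschitz.

Section random_variables.
Context {R : realType} {d : measure_display} {T : measurableType d}.
Variables (H : set (T -> R)) (HH : random_variable_space H).
Implicit Types (X Y : T -> R) (g : R -> R).

Lemma rvs_uni g c X : 0 <= c ->
  (forall x y, `|g x - g y| <= c * (1 + `|x| + `|y|) * `|x - y|) ->
  H X -> H (fun w => g (X w)).
Proof.
move=> c0 gc HX.
have := rvs_comp HH (X := fun _ : 'I_1 => X) (fun _ => HX) (C_lLip_uni c0 gc).
by congr H; apply/funext => w; rewrite mxE.
Qed.

Lemma rvs_lipschitz g L X : 0 <= L -> lipschitz_with L g ->
  H X -> H (fun w => g (X w)).
Proof. by move=> L0 gL; apply: (rvs_uni L0); exact: lipschitz_local. Qed.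

Lemma rvs_cst c : H (fun _ => c).
Proof.
apply: (@rvs_lipschitz (fun _ => c) 0 _ _ _ (rvs_zero HH)) => // x y.
by rewrite subrr normr0 mul0r.
Qed.

Lemma rvs_opp X : H X -> H (fun w => - X w).
Proof.
move=> HX; have := rvs_scale HH (-1) HX.
by congr H; apply/funext => w; rewrite mulN1r.
Qed.

Lemma rvs_sub X Y : H X -> H Y -> H (fun w => X w - Y w).
Proof. by move=> HX HY; exact: (rvs_add HH HX (rvs_opp HY)). Qed.

Lemma rvs_sqr X : H X -> H (fun w => X w ^+ 2).
Proof.
apply: (@rvs_uni (fun x => x ^+ 2) 1) => // x y.
rewrite mul1r subr_sqr normrM mulrC ler_wpM2r//.
by have := ler_normD x y; lra.
Qed.

(** Products are obtained by polarization from squares, so that only functions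
of one variable have to be checked to lie in the test class. *)
Lemma rvs_mul X Y : H X -> H Y -> H (fun w => X w * Y w).
Proof.
move=> HX HY.
have H1 := rvs_sqr (rvs_add HH HX HY).
have H2 := rvs_sub (rvs_sub H1 (rvs_sqr HX)) (rvs_sqr HY).
have := rvs_scale HH 2^-1 H2; congr H; apply/funext => w.
by field.
Qed.

Lemma rvs_sum (I : Type) (s : seq I) (F : I -> T -> R) :
  (forall i, H (F i)) -> H (fun w => \sum_(i <- s) F i w).
Proof.
move=> HF; elim: s => [|i s IH].
  by have := rvs_zero HH; congr H; apply/funext => w; rewrite big_nil.
have := rvs_add HH (HF i) IH.
by congr H; apply/funext => w; rewrite big_cons.
Qed.

End random_variables.

(** * Series and almost sure convergence to zero *)

Section nonnegative_series.
Context {R : realType}.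

(** The sequence t of tail sums, given by its recursion: this is the form in
which both Borel--Cantelli and the excess estimate consume summability. *)
Lemma summable_tail (r : nat -> R) (M : R) : (forall i, 0 <= r i) ->
  (forall n, \sum_(i < n) r i <= M) ->
  exists t : nat -> R, [/\ forall i, 0 <= t i, forall i, t i = r i + t i.+1 &
    t @ \oo --> 0].
Proof.
move=> r0 rM; pose S n := \sum_(i < n) r i.
have Snd : {homo S : m n / (m <= n)%N >-> m <= n}.
  by apply/nondecreasing_seqP => n; rewrite /S big_ord_recr/= lerDl.
have Scvg : cvgn S.
  by apply: nondecreasing_is_cvgn => //; exists M => _ [n _ <-]; exact: rM.
exists (fun i => limn S - S i); split=> [i|i|].
- by rewrite subr_ge0; exact: nondecreasing_cvgn_le.
- by rewrite /S big_ord_recr/=; lra.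
- rewrite -(subrr (limn S)); apply: cvgB => //; exact: cvg_cst.
Qed.

Lemma sum_le_tail (r t : nat -> R) m n : (forall i, 0 <= t i) ->
  (forall i, t i = r i + t i.+1) -> \sum_(i < n) r (m + i)%N <= t m.
Proof.
move=> t0 tr; suff -> : \sum_(i < n) r (m + i)%N = t m - t (m + n)%N.
  by have := t0 (m + n)%N; lra.
elim: n => [|n IH]; first by rewrite big_ord0 addn0 subrr.
by rewrite big_ord_recr/= IH addnS (tr (m + n)%N); lra.
Qed.

(** A geometric contraction driven by a summable input is summable: summing the
recursion over i < n bounds the sum S by c_0 + rho S + M. *)
Lemma summable_recursion (rho : R) (c u : nat -> R) (M : R) :
  0 <= rho < 1 -> (forall i, 0 <= c i) -> (forall n, \sum_(i < n) u i <= M) ->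
  (forall i, c i.+1 = rho * c i + u i) ->
  forall n, \sum_(i < n) c i <= (c 0%N + M) / (1 - rho).
Proof.
move=> /andP[rho0 rho1] c0 uM cS n; rewrite ler_pdivlMr ?subr_gt0//.
have : \sum_(i < n.+1) c i =
    c 0%N + rho * (\sum_(i < n) c i) + \sum_(i < n) u i.
  rewrite big_ord_recl/= -addrA; congr +%R; rewrite mulr_sumr -big_split/=.
  by apply: eq_bigr => i _; rewrite cS.
rewrite big_ord_recr/=; have := c0 n; have := uM n; lra.
Qed.

End nonnegative_series.

Section nonconvergence_set.
Context {R : realType} {d : measure_display} {T : measurableType d}.
Implicit Types f : nat -> T -> R.

(** Failure of convergence to 0 as a countable combination of level sets, which
gives at the same time its measurability and its capacity. *)
Lemma not_cvg0E f : [set w | ~ (f n w @[n --> \oo] --> (0 : R))] =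
  \bigcup_k \bigcap_m \bigcup_n [set w | k.+1%:R^-1 <= `|f (m + n)%N w|].
Proof.
apply/seteqP; split=> w /=.
- apply: contra_notP => nw; apply/cvgr0Pnorm_lt => e e0.
  have [k ke] : exists k, k.+1%:R^-1 < e.
    have := near_infty_natSinv_lt (PosNum e0).
    by move=> [k _ /(_ k (leqnn k))]; exists k.
  apply: contra_notP nw => nw; exists k => // m _.
  apply: contra_notP nw => nw; exists m => // n /= mn.
  rewrite (lt_trans _ ke)// ltNge; apply/negP => kn.
  by apply: nw; exists (n - m)%N => //=; rewrite subnKC.
- move=> [k _ kw] /cvgr0Pnorm_lt/(_ k.+1%:R^-1).
  rewrite invr_gt0 ltr0n => /(_ isT)[m _ mw].
  have [n _ /= nw] := kw m I.
  by have := mw (m + n)%N (leq_addr _ _); rewrite ltNge nw.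
Qed.

Lemma measurable_not_cvg0 f : (forall n, measurable_fun setT (f n)) ->
  measurable [set w | ~ (f n w @[n --> \oo] --> (0 : R))].
Proof.
move=> mf; rewrite not_cvg0E; apply: bigcup_measurable => k _.
apply: bigcap_measurableType => m _; apply: bigcup_measurable => n _.
rewrite -[X in measurable X]setTI; apply: measurable_fun_le => //.
exact: measurableT_comp.
Qed.

End nonconvergence_set.

(** * Upper expectations and the capacity *)

(** An upper bound on the expectation by a real number, bundled with membership
in H.  Having a finite upper bound excludes the forms +oo - oo, so sums of such
bounds need no side condition. *)
Definition mean_le (R : realType) (T : Type) (H : set (T -> R))
    (E : (T -> R) -> \bar R) (X : T -> R) (x : R) : Prop :=
  H X /\ (E X <= x%:E)%E.

Section sublinear_expectation_theory.
Context {R : realType} {d : measure_display} {T : measurableType d}.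
Variables (H : set (T -> R)) (E : (T -> R) -> \bar R).
Hypotheses (HH : random_variable_space H) (HE : sublinear_expectation H E).
Local Notation V := (upper_capacity H E).
Local Notation mle := (mean_le H E).
Implicit Types (X Y : T -> R) (A : set T) (x y c : R).

Lemma mean_le_add X Y x y : mle X x -> mle Y y ->
  mle (fun w => X w + Y w) (x + y).
Proof.
move=> [HX Xx] [HY Yy]; split; first exact: (rvs_add HH).
apply: le_trans (sle_subadditive HE HX HY _) _; last by rewrite EFinD leeD.
by move: Xx Yy; case: (E X) => [a||]; case: (E Y) => [c||].
Qed.

Lemma mean_le_scale X x c : 0 <= c -> mle X x -> mle (fun w => c * X w) (c * x).
Proof.
move=> c0 [HX Xx]; split; first exact: (rvs_scale HH).
by rewrite (sle_homogeneous HE)// EFinM lee_wpmul2l.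
Qed.

Lemma mean_le_mono X Y x : H X -> (forall w, X w <= Y w) -> mle Y x -> mle X x.
Proof.
move=> HX XY [HY Yx]; split=> //; apply: le_trans Yx.
exact: (sle_monotone HE).
Qed.

Lemma mean_le_trans X x y : x <= y -> mle X x -> mle X y.
Proof. by move=> xy [HX Xx]; split=> //; apply: le_trans Xx _; rewrite lee_fin. Qed.

Lemma mean_le_cst c : mle (fun _ => c) c.
Proof. by split; [exact: (rvs_cst HH)|rewrite (sle_cst HE)]. Qed.

Lemma mean_le_sum (F : nat -> T -> R) x n : (forall i, mle (F i) x) ->
  mle (fun w => \sum_(i < n) F i w) (n%:R * x).
Proof.
move=> Fx; elim: n => [|n IH].
  by under eq_fun do rewrite big_ord0; rewrite mul0r; exact: mean_le_cst.
under eq_fun do rewrite big_ord_recr/=.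
by rewrite -natr1 mulrDl mul1r; exact: mean_le_add.
Qed.

Lemma mean_ge0 X : H X -> (forall w, 0 <= X w) -> (0 <= E X)%E.
Proof.
move=> HX X0; have <- : E (fun _ => 0) = 0%E := sle_cst HE 0.
by apply: (sle_monotone HE) => //; exact: (rvs_cst HH).
Qed.

Lemma mean_bounded_fin_num X c : H X -> (forall w, `|X w| <= c) ->
  E X \is a fin_num.
Proof.
move=> HX Xc.
have le1 : (E X <= c%:E)%E.
  rewrite -(sle_cst HE c); apply: (sle_monotone HE) => //; first exact: (rvs_cst HH).
  by move=> w; have := Xc w; rewrite ler_norml => /andP[].
have le2 : ((- c)%:E <= E X)%E.
  rewrite -(sle_cst HE (- c)); apply: (sle_monotone HE) => //; first exact: (rvs_cst HH).
  by move=> w; have := Xc w; rewrite ler_norml => /andP[].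
by move: le1 le2; case: (E X) => [a||].
Qed.

Lemma mean_le_bounded X x c : H X -> (forall w, `|X w| <= c) ->
  mle X x -> exists2 e : R, E X = e%:E & e <= x.
Proof.
move=> HX Xc [_ Xx]; have /fineK eX := mean_bounded_fin_num HX Xc.
by exists (fine (E X)) => //; rewrite -lee_fin eX.
Qed.

Lemma capacity_ge0 A : (0 <= V A)%E.
Proof.
apply: le_ereal_inf_tmp => _ [xi [Hxi Axi] <-]; apply: mean_ge0 => // w.
by apply: le_trans (Axi w); rewrite indicE.
Qed.

Lemma capacity_le A xi x : mle xi x -> (forall w, \1_A w <= xi w) ->
  (V A <= x%:E)%E.
Proof.
by move=> [Hxi xix] Axi; apply: le_trans xix; apply: ereal_inf_lbound; exists xi.
Qed.

Lemma le_capacity A B : A `<=` B -> (V A <= V B)%E.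
Proof.
move=> AB; apply: le_ereal_inf_tmp => _ [xi [Hxi Bxi] <-].
apply: ereal_inf_lbound; exists xi => //; split=> // w; apply: le_trans (Bxi w).
by rewrite !indicE ler_nat; case: (boolP (w \in A)) => // /set_mem/AB/mem_set->.
Qed.

Lemma capacity_setT : V setT = 1%E.
Proof.
apply/eqP; rewrite eq_le; apply/andP; split.
  by apply: capacity_le (mean_le_cst 1) _ => w; rewrite indicE in_setT.
apply: le_ereal_inf_tmp => _ [xi [Hxi xi1] <-].
have <- : E (fun _ => 1) = 1%E := sle_cst HE 1.
apply: (sle_monotone HE) => //; first exact: (rvs_cst HH).
by move=> w; apply: le_trans (xi1 w); rewrite indicE in_setT.
Qed.

(** If xi >= 0 then xi / c dominates the indicator of {xi >= c}. *)
Lemma capacity_markov xi x c : mle xi x -> (forall w, 0 <= xi w) -> 0 < c ->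
  (V [set w | c <= xi w]%R <= (c^-1 * x)%:E)%E.
Proof.
move=> xix xi0 c0; have ci : 0 <= c^-1 by rewrite invr_ge0 ltW.
apply: capacity_le (mean_le_scale ci xix) _ => w.
rewrite indicE; case: (boolP (w \in _)) => [/set_mem/= cxi|_].
  by rewrite mulrC ler_pdivlMr// mul1r.
by rewrite mulr_ge0.
Qed.

Lemma capacity_bigcup_eq0 (N : nat -> set T) : countably_subadditive V ->
  (forall n, measurable (N n)) -> (forall n, V (N n) = 0%E) ->
  V (\bigcup_n N n) = 0%E.
Proof.
move=> Vs mN N0; apply/eqP; rewrite eq_le capacity_ge0 andbT.
by apply: le_trans (Vs _ mN) _; rewrite eseries0.
Qed.

(** By Markov and countable sub-additivity, the event that xi_i >= 1/(k+1) for
some i >= m has capacity at most (k+1) times the m-th tail of the series of the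
r_i, which tends to 0; the exceptional set is the union over k. *)
Lemma borel_cantelli_cvg0 (xi : nat -> T -> R) (r : nat -> R) (M : R) :
  countably_subadditive V ->
  (forall i w, 0 <= xi i w) -> (forall i, mle (xi i) (r i)) ->
  (forall n, \sum_(i < n) r i <= M) ->
  V [set w | ~ (xi n w @[n --> \oo] --> (0 : R))] = 0%E.
Proof.
move=> Vs xi0 xir rM.
have r0 i : 0 <= r i.
  have [Hxi xii] := xir i; rewrite -lee_fin; apply: le_trans xii.
  exact: mean_ge0.
have [t [t0 tr tcvg]] := summable_tail r0 rM.
pose lev k m n := [set w | k.+1%:R^-1 <= `|xi (m + n)%N w|].
have mlev k m n : measurable (lev k m n).
  rewrite /lev -[X in measurable X]setTI; apply: measurable_fun_le => //.
  by apply: measurableT_comp => //; apply: (rvs_measurable HH); case: (xir (m + n)%N).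
have mU k m : measurable (\bigcup_n lev k m n).
  exact: bigcup_measurable.
have mI k : measurable (\bigcap_m \bigcup_n lev k m n).
  exact: bigcap_measurableType.
rewrite not_cvg0E; apply: capacity_bigcup_eq0 => // k.
apply/eqP; rewrite eq_le capacity_ge0 andbT.
have Vt m : (V (\bigcap_m \bigcup_n lev k m n) <= (k.+1%:R * t m)%:E)%E.
  apply: le_trans (le_capacity (_ : _ `<=` \bigcup_n lev k m n)) _.
    exact: bigcap_inf.
  apply: le_trans (Vs _ (mlev k m)) _.
  apply: lime_le.
    by apply: is_cvg_ereal_nneg_natsum_cond => n _ _; exact: capacity_ge0.
  apply: nearW => n; apply: le_trans
    (_ : _ <= \sum_(0 <= i < n) (k.+1%:R * r (m + i)%N)%:E)%E _.
    apply: lee_sum => i _; rewrite -[X in X * _]invrK.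
    rewrite /lev; under eq_set do rewrite ger0_norm//.
    by apply: capacity_markov => //; rewrite invr_gt0.
  rewrite sumEFin lee_fin -mulr_sumr big_mkord ler_wpM2l//.
  exact: sum_le_tail.
apply/lee_addgt0Pr => e e0; rewrite add0e.
have : (fun n => k.+1%:R * t n) @ \oo --> k.+1%:R * (0 : R).
  by apply: cvgM tcvg; exact: cvg_cst.
rewrite mulr0 => /cvgr0Pnorm_lt/(_ e e0)[m _ /(_ m (leqnn m))/= me].
apply: le_trans (Vt m) _; rewrite lee_fin; apply: le_trans (ltW me).
exact: ler_norm.
Qed.

End sublinear_expectation_theory.

(** * Dyadic tails from the Choquet integral *)

Section cauchy_condensation.
Context {R : realType}.
Notation mu := (@lebesgue_measure R).

(** On ]2^n, 2^(n+1)], an interval of length 2^n, the function F is at least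
F(2^(n+1)). *)
Lemma condensation_le_integral (F : R -> R) n :
  (forall x y, x <= y -> F y <= F x) -> (forall x, 0 <= F x) ->
  ((2^-1 * \sum_(j < n.+1) 2 ^+ j * F (2 ^+ j))%:E
    <= \int[mu]_(t in `]0%R, (2 ^+ n)%R]) (F t)%:E)%E.
Proof.
move=> Fni F0.
have mF (D : set R) : measurable D -> measurable_fun D (fun t => (F t)%:E).
  by move=> mD; apply/measurable_EFinP; exact: nonincreasing_measurable.
have int_ge (a b : R) : a <= b ->
    (((b - a) * F b)%:E <= \int[mu]_(t in `]a, b]) (F t)%:E)%E.
  move=> ab; apply: le_trans
    (_ : _ <= \int[mu]_(t in `]a, b]) (cst (F b)%:E t))%E _.
    rewrite integral_cst//= lebesgue_measure_itv/= lte_fin.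
    case: ltgtP ab => // [ab _|-> _].
      by rewrite -EFinD -EFinM mulrC.
    by rewrite subrr mul0r mule0.
  apply: ge0_le_integral => //=.
  - by move=> t _; rewrite lee_fin.
  - exact: mF.
  - by move=> t; rewrite in_itv/= lee_fin => /andP[_ tb]; exact: Fni.
elim: n => [|n IH].
  rewrite big_ord1 expr0 mul1r; apply: le_trans (int_ge 0 1 ler01).
  by rewrite lee_fin subr0 mul1r ler_piMl//; lra.
have le2 : 2 ^+ n <= 2 ^+ n.+1 :> R by rewrite ler_weXn2l//; lra.
have -> : `]0%R, (2 ^+ n.+1)%R]%classic =
    `]0%R, (2 ^+ n)%R] `|` `]2 ^+ n, 2 ^+ n.+1] :> set R.
  by rewrite -itv_bndbnd_setU// bnd_simp// exprn_ge0.
rewrite ge0_integral_setU//; last 3 first.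
- by apply: mF; exact: measurableU.
- by move=> x _; rewrite lee_fin.
- rewrite disj_set2E; apply/eqP; rewrite -subset0 => t [] /=.
  by rewrite !in_itv/= => /andP[_ t1] /andP[t2 _]; move: (lt_le_trans t2 t1); rewrite ltxx.
rewrite big_ord_recr/= mulrDr EFinD leeD//.
apply: le_trans (int_ge _ _ le2); rewrite lee_fin exprS mulrA mulrA.
by rewrite mulVf// mul1r; have -> : 2 * 2 ^+ n - 2 ^+ n = 2 ^+ n :> R by lra.
Qed.

End cauchy_condensation.

Definition dyadic_scale (R : realType) (p : R) : R := 2 `^ p^-1.

Section dyadic_scale_theory.
Context {R : realType} (p : R).
Hypothesis p0 : 0 < p.
Local Notation b := (dyadic_scale p).

Lemma dyadic_scale_gt0 : 0 < b.
Proof. by rewrite powR_gt0. Qed.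

Lemma dyadic_scaleX j : b ^+ j = (2 ^+ j) `^ p^-1.
Proof.
by rewrite -powR_mulrn ?powR_ge0// -powRrM mulrC powRrM powR_mulrn.
Qed.

Lemma dyadic_scaleX_powR j : (b ^+ j) `^ p = 2 ^+ j.
Proof. by rewrite dyadic_scaleX -powRrM mulVf ?gt_eqF// powRr1. Qed.

Lemma dyadic_scale_powR : b `^ p = 2.
Proof. by have := dyadic_scaleX_powR 1; rewrite !expr1. Qed.

End dyadic_scale_theory.

Section dyadic_scale_bounds.
Context {R : realType}.

Lemma dyadic_scale_decreasing (p q : R) : 0 < p -> p < q ->
  dyadic_scale q < dyadic_scale p.
Proof.
move=> p0 pq; rewrite /dyadic_scale /powR gt_eqF// ltr_expR.
rewrite ltr_pM2r ?ln_gt0 ?ltr1n// ltf_pV2// posrE; exact: lt_trans pq.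
Qed.

Lemma dyadic_scale1 : dyadic_scale (1 : R) = 2.
Proof. by rewrite /dyadic_scale invr1 powRr1. Qed.

Lemma dyadic_scale2 : dyadic_scale (2 : R) ^+ 2 = 2.
Proof.
by rewrite -powR_mulrn ?powR_ge0// dyadic_scale_powR.
Qed.

Lemma dyadic_scale_gt1 (p : R) : 0 < p -> 1 < dyadic_scale p.
Proof.
move=> p0; rewrite /dyadic_scale /powR gt_eqF// expR_gt1.
by rewrite mulr_gt0 ?invr_gt0// ln_gt0// ltr1n.
Qed.

End dyadic_scale_bounds.

Section choquet_tails.
Context {R : realType} {d : measure_display} {T : measurableType d}.
Variables (H : set (T -> R)) (E : (T -> R) -> \bar R).
Hypotheses (HH : random_variable_space H) (HE : sublinear_expectation H E).
Local Notation V := (upper_capacity H E).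
Local Notation mle := (mean_le H E).
Notation mu := (@lebesgue_measure R).

(** For t <= 0 the event {Y >= t} is everything, and the capacity of the whole
space is 1, so the integral over the negative half-line vanishes. *)
Lemma choquet_integral_ge0E (Y : T -> R) : (forall w, 0 <= Y w) ->
  choquet_integral V Y = (\int[mu]_(t in `[0%R, +oo[) V [set w | t <= Y w]%R)%E.
Proof.
move=> Y0; rewrite /choquet_integral [X in (_ + X)%E](_ : _ = 0%E) ?adde0//.
apply: integral0_eq => t; rewrite /= in_itv/= => t0.
rewrite (_ : [set w | _] = setT) ?(capacity_setT HH HE) ?subee//.
by apply/seteqP; split=> // w _ /=; exact: le_trans (Y0 w).
Qed.

Lemma dyadic_sum_le_choquet (Y : T -> R) : (forall w, 0 <= Y w) ->
  (choquet_integral V Y < +oo)%E ->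
  exists M : R, forall n,
    \sum_(j < n) 2 ^+ j * fine (V [set w | 2 ^+ j <= Y w]) <= M.
Proof.
move=> Y0; rewrite choquet_integral_ge0E//; set I := (X in (X < _)%E) => Ioo.
pose F t := fine (V [set w | t <= Y w]).
have Vle1 A : (V A <= 1)%E.
  by rewrite -(capacity_setT HH HE); apply: le_capacity.
have FE t : (F t)%:E = V [set w | t <= Y w].
  rewrite fineK// ge0_fin_numE ?(capacity_ge0 HH HE)//.
  exact: le_lt_trans (Vle1 _) (ltry _).
have F0 t : 0 <= F t by rewrite -lee_fin FE (capacity_ge0 HH HE).
have Fni x y : x <= y -> F y <= F x.
  move=> xy; rewrite -lee_fin !FE; apply: le_capacity => w /=.
  exact: le_trans.
have I0 : (0 <= I)%E by apply: integral_ge0 => t _; exact: (capacity_ge0 HH HE).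
exists (2 * fine I) => n.
apply: le_trans (_ : _ <= \sum_(j < n.+1) 2 ^+ j * F (2 ^+ j)) _.
  by rewrite big_ord_recr/= lerDl mulr_ge0// exprn_ge0.
rewrite -ler_pdivrMl// -lee_fin fineK ?ge0_fin_numE//.
apply: le_trans (condensation_le_integral n Fni F0) _.
rewrite /I; under [leRHS]eq_integral do rewrite -FE.
apply: ge0_subset_integral => //.
- apply/measurable_EFinP; exact: nonincreasing_measurable.
- by move=> t _; rewrite lee_fin.
- by move=> t /=; rewrite !in_itv/= andbT => /andP[/ltW].
Qed.

(** The capacity is an infimum that need not be attained, so the tail indicators
are replaced by variables xi_j >= 0 that are at least 1 on {|X| >= b^j} and whose
expectation u_j exceeds the capacity by a summable error. *)
Lemma choquet_tails p (X : T -> R) : 0 < p ->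
  (choquet_integral V (fun w => `|X w| `^ p)%R < +oo)%E ->
  exists (xi : nat -> T -> R) (u : nat -> R) (M : R),
    [/\ forall j, mle (xi j) (u j), forall j w, 0 <= xi j w,
        forall j w, dyadic_scale p ^+ j <= `|X w| -> 1 <= xi j w &
        forall n, \sum_(j < n) 2 ^+ j * u j <= M].
Proof.
move=> p0 cX.
have [|M sumM] := dyadic_sum_le_choquet _ cX; first by move=> w; exact: powR_ge0.
pose A j := [set w | 2 ^+ j <= `|X w| `^ p].
have VA j : V (A j) \is a fin_num.
  rewrite ge0_fin_numE ?(capacity_ge0 HH HE)//.
  apply: le_lt_trans (ltry 1); rewrite -(capacity_setT HH HE).
  exact: le_capacity.
(* The error 4^(-j) makes the infimum strictly smaller than u_j, while its
   weight 2^j 4^(-j) sums to at most 2. *)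
pose u j : R := fine (V (A j)) + (2 ^+ j * 2 ^+ j)^-1.
have /choice[xi xiP] j : exists xi : T -> R,
    [/\ H xi, forall w, \1_(A j) w <= xi w & (E xi <= (u j)%:E)%E].
  have : (V (A j) < (u j)%:E)%E.
    by rewrite -(fineK (VA j)) lte_fin ltrDl invr_gt0 mulr_gt0// exprn_gt0.
  by move=> /ereal_inf_lt[_ [xi [Hxi Axi] <-] /ltW Exi]; exists xi.
exists xi, u, (M + 2); split.
- by move=> j; have [] := xiP j.
- by move=> j w; have [_ + _] := xiP j => /(_ w); apply: le_trans; rewrite indicE.
- move=> j w Xw; have [_ + _] := xiP j => /(_ w); apply: le_trans.
  rewrite indicE mem_set// /A/= -(dyadic_scaleX_powR p0) ge0_ler_powR//.
  - exact: ltW.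
  - by rewrite nnegrE exprn_ge0// ltW// dyadic_scale_gt0.
- move=> n; under eq_bigr do rewrite mulrDr; rewrite big_split/=; apply: lerD (sumM n) _.
  suff -> : \sum_(i < n) 2 ^+ i * (2 ^+ i * 2 ^+ i)^-1 = 2 - 2 * (2 ^+ n)^-1 :> R.
    by rewrite gerDl oppr_le0 mulr_ge0// invr_ge0 exprn_ge0.
  elim: n => [|n IH]; first by rewrite big_ord0 expr0; lra.
  rewrite big_ord_recr/= {}IH exprS; field.
  by rewrite expf_neq0.
Qed.

End choquet_tails.

(** * Truncations *)

Section truncations.
Context {R : realType}.
Implicit Types (f g : R -> R) (b c x L B : R).

Lemma lipschitz_with_mul f g B1 B2 L1 L2 : (forall x, `|f x| <= B1) ->
  (forall x, `|g x| <= B2) -> lipschitz_with L1 f -> lipschitz_with L2 g ->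
  lipschitz_with (B1 * L2 + B2 * L1) (fun x => f x * g x).
Proof.
move=> fB gB fL gL x y.
have -> : f x * g x - f y * g y = f x * (g x - g y) + g y * (f x - f y) by ring.
apply: le_trans (ler_normD _ _) _; rewrite !normrM mulrDl -!mulrA.
by apply: lerD; apply: ler_pM.
Qed.

Lemma lipschitz_with_pow f L q : (forall x, `|f x| <= 1) ->
  lipschitz_with L f -> lipschitz_with (q%:R * L) (fun x => f x ^+ q).
Proof.
move=> f1 fL; elim: q => [|q IH] x y.
  by rewrite !expr0 subrr normr0 mul0r mul0r.
have fq z : `|f z ^+ q| <= 1 by rewrite normrX exprn_ile1.
have -> : q.+1%:R * L = 1 * (q%:R * L) + 1 * L by rewrite -natr1; ring.
rewrite !exprS; exact: (lipschitz_with_mul f1 fq fL IH).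
Qed.

Definition capped c x : R := Num.min (`|x| / c) 1.
Definition clip c x : R := Num.max (Num.min x c) (- c).
Definition excess c x : R := Num.max (`|x| - c) 0.

Lemma capped_ge0 c x : 0 < c -> 0 <= capped c x.
Proof. by move=> c0; rewrite le_min ler01 andbT mulr_ge0// invr_ge0 ltW. Qed.

Lemma capped_le1 c x : capped c x <= 1.
Proof. by rewrite ge_min lexx orbT. Qed.

Lemma norm_capped_le1 c x : 0 < c -> `|capped c x| <= 1.
Proof. by move=> c0; rewrite ger0_norm ?capped_ge0// capped_le1. Qed.

Lemma lipschitz_capped c : 0 < c -> lipschitz_with c^-1 (capped c).
Proof.
move=> c0 x y; apply: le_trans (dist_minr _ _ _) _.
have ci : 0 < c^-1 by rewrite invr_gt0.
by rewrite -mulrBl normrM mulrC gtr0_norm// ler_pM2l// ler_dist_dist.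
Qed.

Lemma capped_lt1 c x : 0 < c -> capped c x < 1 -> `|x| = c * capped c x.
Proof.
move=> c0; rewrite /capped gt_min ltxx orbF => xc.
by rewrite (min_idPl (ltW xc)) mulrC divfK// gt_eqF.
Qed.

Lemma capped_lt1_norm c x : 0 < c -> capped c x < 1 -> `|x| < c.
Proof. by move=> c0 x1; rewrite (capped_lt1 c0 x1) gtr_pMr. Qed.

(** Below the level c both sides are powers of |x| and scale exactly; above it,
the capped function is at most 1 <= z. *)
Lemma capped_rescale b c x (z : R) q : 0 < b -> 0 < c -> 0 <= z ->
  (c <= `|x| -> 1 <= z) ->
  capped (c * b) x ^+ q <= (b ^+ q)^-1 * capped c x ^+ q + z.
Proof.
move=> b0 c0 z0 cz; have [cx|xc] := leP c `|x|.
  apply: le_trans (_ : 1 <= _).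
    by rewrite exprn_ile1 ?capped_ge0 ?capped_le1// mulr_gt0.
  rewrite -[1]add0r lerD ?cz// mulr_ge0 ?invr_ge0 ?exprn_ge0 ?capped_ge0//.
  exact: ltW.
have xc1 : `|x| / c <= 1 by rewrite ler_pdivrMr// mul1r ltW.
have -> : capped c x = `|x| / c by rewrite /capped (min_idPl xc1).
apply: le_trans (_ : (`|x| / (c * b)) ^+ q <= _).
  have cb : 0 < c * b by rewrite mulr_gt0.
  apply: lerXn2r; rewrite ?nnegrE; first exact: capped_ge0.
    by rewrite divr_ge0// ltW.
  by rewrite /capped ge_min lexx.
have -> : `|x| / (c * b) = b^-1 * (`|x| / c) by rewrite invfM; ring.
by rewrite exprMn exprVn lerDl.
Qed.

Lemma lipschitz_clip c : lipschitz_with 1 (clip c).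
Proof.
move=> x y; rewrite mul1r; apply: le_trans (dist_maxr _ _ _) _.
exact: dist_minr.
Qed.

Lemma clip_id c x : `|x| < c -> clip c x = x.
Proof.
rewrite ltr_norml => /andP[cx xc]; rewrite /clip.
by rewrite (min_idPl (ltW xc)) (max_idPl (ltW cx)).
Qed.

Lemma norm_clip c x : 0 < c -> `|clip c x| = c * capped c x.
Proof.
move=> c0; rewrite /clip /capped.
have -> : Num.min (`|x| / c) 1 = Num.min `|x| c / c.
  by rewrite minr_pMl ?invr_ge0 1?ltW// divff// gt_eqF.
rewrite mulrC divfK ?gt_eqF//.
have [x0|x0] := leP 0 x.
  rewrite (ger0_norm x0) max_l; last by rewrite le_min; lra.
  by rewrite ger0_norm// le_min x0 ltW.
have xc : x <= c by lra.
rewrite (ltr0_norm x0) (min_idPl xc) ltr0_norm; last by rewrite gt_max x0; lra.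
by rewrite oppr_max opprK.
Qed.

Lemma norm_clip_le c x : 0 < c -> `|clip c x| <= c.
Proof. by move=> c0; rewrite norm_clip// ger_pMr ?capped_le1. Qed.

Lemma dist_clip_le c x : 0 < c -> `|x - clip c x| <= excess c x.
Proof.
move=> c0; have [xc|] := ltP `|x| c.
  by rewrite clip_id// subrr normr0 le_max lexx orbT.
rewrite /clip /excess => cx; rewrite le_max; apply/orP; left.
have [x0|x0] := leP 0 x.
  have xc : c <= x by rewrite -(ger0_norm x0).
  rewrite (min_idPr xc) max_l; last lra.
  by rewrite (ger0_norm x0) ger0_norm ?subr_ge0.
have xc : x <= - c by move: cx; rewrite ltr0_norm//; lra.
rewrite min_l ?max_r//; last lra.
by rewrite opprK (ltr0_norm x0) ler0_norm; lra.
Qed.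

Lemma lipschitz_excess c : lipschitz_with 1 (excess c).
Proof.
move=> x y; rewrite mul1r; apply: le_trans (dist_maxr _ _ _) _.
by rewrite opprB addrA subrK ler_dist_dist.
Qed.

(** Raising the truncation level from c to c b costs at most c b, and only where
|x| >= c. *)
Lemma excess_rescale b c x (z : R) : 1 <= b -> 0 < c -> 0 <= z ->
  (c <= `|x| -> 1 <= z) -> excess c x <= c * b * z + excess (c * b) x.
Proof.
move=> b1 c0 z0 cz; rewrite /excess.
have cb : c <= c * b by rewrite ler_peMr// ltW.
have [cx|xc] := leP c `|x|; last first.
  rewrite max_r; last lra.
  by rewrite addr_ge0// ?le_max ?lexx ?orbT// !mulr_ge0//; lra.
have : c * b <= c * b * z by rewrite ler_peMr ?cz//; lra.
rewrite max_l ?subr_ge0//; move=> h.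
have : `|x| - c * b <= Num.max (`|x| - c * b) 0 by rewrite le_max lexx.
lra.
Qed.

End truncations.

Section capped_moments.
Context {R : realType} {d : measure_display} {T : measurableType d}.
Variables (H : set (T -> R)) (E : (T -> R) -> \bar R).
Hypotheses (HH : random_variable_space H) (HE : sublinear_expectation H E).
Local Notation mle := (mean_le H E).

Lemma rvs_capped_pow c q (Y : T -> R) : 0 < c -> H Y ->
  H (fun w => capped c (Y w) ^+ q).
Proof.
move=> c0; apply: (rvs_lipschitz HH (g := fun x => capped c x ^+ q) (L := q%:R * c^-1)).
  by rewrite mulr_ge0// invr_ge0 ltW.
apply: lipschitz_with_pow (lipschitz_capped c0) => x; exact: norm_capped_le1.
Qed.

Variables (b : R) (Y : T -> R) (xi : nat -> T -> R) (u : nat -> R) (M : R).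
Hypotheses (b1 : 1 < b) (HY : H Y) (xiu : forall j, mle (xi j) (u j)).
Hypotheses (xi0 : forall j w, 0 <= xi j w).
Hypothesis xi1 : forall j w, b ^+ j <= `|Y w| -> 1 <= xi j w.
Hypothesis sumM : forall n, \sum_(j < n) 2 ^+ j * u j <= M.

Let b0 : 0 < b. Proof. exact: lt_trans b1. Qed.
Let bX0 i : 0 < b ^+ i. Proof. by rewrite exprn_gt0. Qed.

Let u0 j : 0 <= u j.
Proof.
have [Hxi Exi] := xiu j; rewrite -lee_fin; apply: le_trans Exi.
exact: (mean_ge0 HH HE).
Qed.

(** Write a_i for the bound on 2^i E[min(|Y| / b^i, 1)^q].  By [capped_rescale],
passing from b^i to b^(i+1) multiplies the expectation by b^(-q) and adds u_i,
so a_(i+1) = (2 / b^q) a_i + 2 * 2^i u_i with 2 / b^q < 1. *)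
Lemma capped_moments q : 2 < b ^+ q -> exists (a : nat -> R) (M' : R),
  [/\ forall i, 0 <= a i, forall n, \sum_(i < n) a i <= M' &
      forall i, mle (fun w => capped (b ^+ i) (Y w) ^+ q) (a i / 2 ^+ i)].
Proof.
move=> bq; pose rho := 2 / b ^+ q.
have rho01 : 0 <= rho < 1.
  by rewrite divr_ge0 ?exprn_ge0 ?(ltW b0)//= ltr_pdivrMr ?mul1r.
pose a := fix a i := if i is j.+1 then rho * a j + 2 * (2 ^+ j * u j) else 1.
have a0 i : 0 <= a i.
  elim: i => //= i IH; case/andP: rho01 => r0 _.
  by apply: addr_ge0; [exact: mulr_ge0|rewrite !mulr_ge0// exprn_ge0].
exists a, ((1 + 2 * M) / (1 - rho)); split=> //.
  apply: (summable_recursion rho01 a0 (u := fun j => 2 * (2 ^+ j * u j))) => // n.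
  by rewrite -mulr_sumr ler_pM2l.
elim=> [|i IH].
  rewrite expr0 divr1; apply: mean_le_mono (mean_le_cst HH HE 1) => //.
    exact: rvs_capped_pow.
  by move=> w; rewrite exprn_ile1 ?capped_ge0 ?capped_le1.
have bqi : 0 <= (b ^+ q)^-1 by rewrite invr_ge0 exprn_ge0// ltW.
have -> : a i.+1 / 2 ^+ i.+1 = (b ^+ q)^-1 * (a i / 2 ^+ i) + u i.
  rewrite /= exprS /rho; field.
  by rewrite !expf_neq0// gt_eqF.
apply: mean_le_mono (mean_le_add HH HE (mean_le_scale HH HE bqi IH) (xiu i)) => //.
  exact: rvs_capped_pow.
by move=> w; rewrite exprSr; apply: capped_rescale => //; exact: xi1.
Qed.

(** Iterating [excess_rescale] from level b^i to level b^(i+k) adds the costs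
b^(j+1) u_j = b (b/2)^j (2^j u_j) for i <= j < i + k; since b/2 <= 1 these add
up to at most b (b/2)^i times the tail t_i.  The remaining excess at level b^(i+k)
vanishes as k grows. *)
Lemma mean_excess_le (t : nat -> R) : b <= 2 -> (forall i, 0 <= t i) ->
  (forall i, t i = 2 ^+ i * u i + t i.+1) ->
  (fun a : R => E (fun w => Num.max (`|Y w| - a) 0)) @ +oo --> 0%E ->
  forall i, mle (fun w => excess (b ^+ i) (Y w)) (b * (b / 2) ^+ i * t i).
Proof.
move=> b2 t0 tS Elim; pose D i := b * (b / 2) ^+ i * t i.
have Hexc c : H (fun w => excess c (Y w)).
  by exact: (rvs_lipschitz HH ler01 (lipschitz_excess c)).
have D0 i : 0 <= D i.
  by rewrite !mulr_ge0// ?exprn_ge0 ?divr_ge0// ltW.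
have DS i : b ^+ i * b * u i + D i.+1 <= D i.
  rewrite /D (tS i) mulrDr; apply: lerD.
    rewrite expr_div_n le_eqVlt; apply/orP; left; apply/eqP; field.
    by rewrite expf_neq0.
  rewrite ler_wpM2r// ler_pM2l// exprSr ler_piMr ?exprn_ge0 ?divr_ge0 ?(ltW b0)//.
  by rewrite ler_pdivrMr// mul1r.
have step k i a : mle (fun w => excess (b ^+ (i + k)) (Y w)) a ->
    mle (fun w => excess (b ^+ i) (Y w)) (D i - D (i + k)%N + a).
  elim: k a => [|k IH] a; first by rewrite addn0 subrr add0r.
  rewrite addnS => ha.
  have bu : 0 <= b ^+ (i + k) * b by rewrite mulr_ge0 ?(ltW (bX0 _)) ?(ltW b0).
  have /IH : mle (fun w => excess (b ^+ (i + k)) (Y w))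
      (b ^+ (i + k) * b * u (i + k)%N + a).
    apply: mean_le_mono
      (mean_le_add HH HE (mean_le_scale HH HE bu (xiu (i + k)%N)) ha) => //.
    by move=> w; rewrite exprSr; apply: excess_rescale => //; [exact: ltW|exact: xi1].
  apply: mean_le_trans; have := DS (i + k)%N; lra.
move=> i; split=> //; apply/lee_addgt0Pr => e e0.
have /fine_cvgP[Efin /cvgr0Pnorm_lt/(_ e e0) Ee] := Elim.
have [A [_ EA]] : \forall a \near +oo,
    (E (fun w => Num.max (`|Y w| - a) 0)%R <= e%:E)%E.
  near=> a.
  have fa : E (fun w => Num.max (`|Y w| - a) 0) \is a fin_num by near: a.
  rewrite -(fineK fa) lee_fin ltW//; apply: le_lt_trans (ler_norm _) _.
  by near: a.
have [k Ak] : exists k, A < b ^+ k.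
  have ib : `|b^-1| < 1 by rewrite gtr0_norm ?invr_gt0// invf_lt1.
  have A1 : 0 < (`|A| + 1)^-1 by rewrite invr_gt0 ltr_wpDl.
  have /cvgr0Pnorm_lt/(_ _ A1)[k _ /(_ k (leqnn k))/=] := cvg_expr ib.
  rewrite exprVn gtr0_norm ?invr_gt0// ltf_pV2 ?posrE// ?ltr_wpDl// => Ak.
  by exists k; have := ler_norm A; lra.
have hik : mle (fun w => excess (b ^+ (i + k)) (Y w)) e.
  split=> //; apply: EA; apply: lt_le_trans Ak _.
  by rewrite ler_weXn2l ?(ltW b1)// leq_addl.
have [_ le1] := step k i e hik; apply: le_trans le1 _.
by rewrite -EFinD lee_fin; have := D0 (i + k)%N; rewrite /D; lra.
Unshelve. all: by end_near.
Qed.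

End capped_moments.

(** * The reflected walk *)

Section lindley.
Context {R : realType}.
Implicit Types z : nat -> R.

(** The Lindley recursion of queueing theory; lindley z n is the largest of the
sums of z over the final segments of {0, ..., n-1}, the empty one included. *)
Fixpoint lindley z n : R :=
  if n is n'.+1 then Num.max (lindley z n' + z n') 0 else 0.

Lemma lindley_ge0 z n : 0 <= lindley z n.
Proof. by case: n => //= n; rewrite le_max lexx orbT. Qed.

Lemma sum_le_lindley z m n : \sum_(m <= k < n) z k <= lindley z n.
Proof.
elim: n => [|n IH]; first by rewrite big_geq.
have [mn|nm] := leqP m n; last by rewrite big_geq//; exact: lindley_ge0.
by rewrite big_nat_recr//= le_max lerD2r IH.
Qed.

Lemma lindley_sqr_le z n :
  lindley z n.+1 ^+ 2 <= lindley z n ^+ 2 + 2 * (lindley z n * z n) + z n ^+ 2.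
Proof.
have -> : lindley z n ^+ 2 + 2 * (lindley z n * z n) + z n ^+ 2 =
          (lindley z n + z n) ^+ 2 by ring.
rewrite /=; set a := _ + _; have [a0|a0] := leP a 0.
  by rewrite expr0n sqr_ge0.
by [].
Qed.

Lemma norm_lindley_le z c n : (forall k, `|z k| <= c) ->
  `|lindley z n| <= n%:R * c.
Proof.
move=> zc; rewrite ger0_norm ?lindley_ge0//; elim: n => [|n IH].
  by rewrite mul0r.
have c0 : 0 <= c := le_trans (normr_ge0 _) (zc 0%N).
rewrite /= ge_max mulr_ge0// andbT -natr1 mulrDl mul1r lerD//.
exact: le_trans (ler_norm _) (zc n).
Qed.

Lemma dist_lindley_le z z' n :
  `|lindley z n - lindley z' n| <= \sum_(k < n) `|z k - z' k|.
Proof.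
elim: n => [|n IH]; first by rewrite big_ord0 subrr normr0.
rewrite big_ord_recr/=; apply: le_trans (dist_maxr _ _ _) _.
by rewrite opprD addrACA; apply: le_trans (ler_normD _ _) _; rewrite lerD2r.
Qed.

Lemma eq_lindley z z' n : (forall k, (k < n)%N -> z k = z' k) ->
  lindley z n = lindley z' n.
Proof.
elim: n => //= n IH zz'; rewrite IH ?zz'//.
by move=> k kn; apply: zz'; exact: ltnW.
Qed.

End lindley.

Section iid_moments.
Context {R : realType} {d : measure_display} {T : measurableType d}.
Variables (H : set (T -> R)) (E : (T -> R) -> \bar R) (X : nat -> T -> R).
Hypotheses (HH : random_variable_space H) (HE : sublinear_expectation H E).
Hypotheses (HX : forall n, H (X n)) (iid : iid_sequence H E X).
Local Notation mle := (mean_le H E).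

(** Equality in law gives equal expectations only where these are finite, hence
the boundedness of g. *)
Lemma mean_le_identical (g : R -> R) c L x k : 0 <= L ->
  (forall y, `|g y| <= c) -> lipschitz_with L g ->
  mle (fun w => g (X 0%N w)) x -> mle (fun w => g (X k w)) x.
Proof.
move=> L0 gc gL gx.
have Hg j : H (fun w => g (X j w)) by exact: (rvs_lipschitz HH L0 gL).
have fg j := mean_bounded_fin_num HH HE (Hg j) (fun w => gc (X j w)).
split=> //; case: gx => _; apply: le_trans.
have := iid.2 k _ (C_lLip_uni L0 (lipschitz_local L0 gL)).
have eqg j : (fun w => g (random_vector (fun=> X j) w ord0 ord0 : R)) =
    (fun w => g (X j w)) by apply/funext => w; rewrite mxE.
by rewrite /= !eqg => ->.
Qed.

Section reflected_walk.
Variables (f : R -> R) (c L : R).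
Hypotheses (L0 : 0 <= L) (fc : forall x, `|f x| <= c).
Hypotheses (fL : lipschitz_with L f).
Let W n w := lindley (fun k => f (X k w)) n.

Let c0 : 0 <= c. Proof. exact: le_trans (normr_ge0 _) (fc 0). Qed.

Let Hf k : H (fun w => f (X k w)).
Proof. exact: (rvs_lipschitz HH L0 fL). Qed.

Lemma rvs_lindley n : H (W n).
Proof.
elim: n => [|n IH]; first exact: rvs_zero.
apply: (rvs_lipschitz HH (g := Num.max^~ 0) (L := 1)) => //.
  by move=> x y; rewrite mul1r dist_maxr.
exact: (rvs_add HH).
Qed.

(** For a fixed past x the inner expectation is E[G(x) f(X_n)] = G(x) E[f(X_n)],
by positive homogeneity, because the value G(x) of the walk is nonnegative; and
E[f(X_n)] <= 0.  Boundedness of f makes the product globally Lipschitz, hence an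
admissible test function. *)
Lemma mean_lindley_mul_le0 n : mle (fun w => f (X 0%N w)) 0 ->
  mle (fun w => W n w * f (X n w)) 0.
Proof.
move=> f0; split; first exact: (rvs_mul HH (rvs_lindley n)).
case: n => [|i].
  rewrite (_ : (fun _ => _) = fun _ => 0) ?(sle_cst HE)//.
  by apply/funext => w; rewrite /W/= mul0r.
have [e eE e0] := mean_le_bounded HH HE (Hf i.+1)
  (fun w => fc (X i.+1 w)) (mean_le_identical i.+1 L0 fc fL f0).
(* The walk reads a sequence, the vector has i + 1 coordinates: inord pads with
   coordinates of index 0, which lindley _ i.+1 never reads. *)
pose G (z : 'I_i.+1 -> R) := lindley (fun k => f (z (inord k))) i.+1.
pose phi (z : 'rV[R]_(i.+1 + 1)) :=
  G (fun k => z ord0 (lshift 1 k)) * f (z ord0 (rshift i.+1 ord0)).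
have GW w : G (fun k => X k w) = W i.+1 w.
  by apply: eq_lindley => k ki; rewrite inordK.
have phi_lip : C_lLip phi.
  apply: (@C_lLip_lipschitz _ _ _ (i.+1%:R * c * L + c * L)).
    by rewrite addr_ge0// !mulr_ge0.
  move=> x y; rewrite /phi big_split_ord/= big_ord1.
  set Gx := G _; set Gy := G _; set fx := f _; set fy := f _.
  have -> : Gx * fx - Gy * fy = Gx * (fx - fy) + fy * (Gx - Gy) by ring.
  apply: le_trans (ler_normD _ _) _; rewrite !normrM.
  have Gc : `|Gx| <= i.+1%:R * c by exact: norm_lindley_le.
  have fl : `|fx - fy| <= L * `|x ord0 (rshift i.+1 ord0) - y ord0 (rshift i.+1 ord0)|.
    exact: fL.
  have Gl : `|Gx - Gy| <=
      L * \sum_(k < i.+1) `|x ord0 (lshift 1 k) - y ord0 (lshift 1 k)|.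
    apply: le_trans (dist_lindley_le _ _ _) _.
    rewrite mulr_sumr; apply: ler_sum => k _; rewrite inord_val; exact: fL.
  set a := \sum_(_ < _) _ in Gl *; set b := `|x _ _ - _| in fl *.
  have a0 : 0 <= a by exact: sumr_ge0.
  have b0 : 0 <= b by exact: normr_ge0.
  have n0 : 0 <= i.+1%:R * c by rewrite mulr_ge0.
  have h1 : `|Gx| * `|fx - fy| <= i.+1%:R * c * (L * b) by exact: ler_pM.
  have h2 : `|fy| * `|Gx - Gy| <= c * (L * a) by apply: ler_pM => //; exact: fc.
  apply: le_trans (lerD h1 h2) _; rewrite -subr_ge0.
  have -> : (i.+1%:R * c * L + c * L) * (a + b) -
    (i.+1%:R * c * (L * b) + c * (L * a)) = i.+1%:R * c * L * a + c * L * b by ring.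
  by rewrite addr_ge0// !mulr_ge0.
pose Z w := e * W i.+1 w.
have HZ : H Z by exact: (rvs_scale HH e (rvs_lindley _)).
have W0 w : 0 <= W i.+1 w by exact: lindley_ge0.
have Wc w : `|W i.+1 w| <= i.+1%:R * c by exact: norm_lindley_le.
have phibar x : E (fun w => phi (row_mx x
      (random_vector (fun _ : 'I_1 => X i.+1) w))) = (G (x ord0) * e)%:E.
  rewrite EFinM -eE -(sle_homogeneous HE) ?lindley_ge0//.
  by congr E; apply/funext => w; rewrite /phi row_mxEr mxE; congr (G _ * _);
     apply/funext => k; rewrite row_mxEl.
have := iid.1 i phi phi_lip _ Z HZ.
have -> : (fun w => phi (row_mx (random_vector (fun j : 'I_i.+1 => X j) w)
      (random_vector (fun _ : 'I_1 => X i.+1) w))) =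
    (fun w => W i.+1 w * f (X i.+1 w)).
  apply/funext => w; rewrite /phi row_mxEr mxE -GW; congr (G _ * _).
  by apply/funext => k; rewrite row_mxEl mxE.
move=> ->.
- have <- : E (fun=> 0) = 0%:E := sle_cst HE 0.
  apply: (sle_monotone HE) => //; first exact: rvs_zero.
  by move=> w; exact: mulr_le0_ge0 e0 (W0 w).
- by move=> x; rewrite phibar ltry.
- move=> w; rewrite phibar /Z -GW mulrC; congr (_ * G _)%:E.
  by apply/funext => k; rewrite mxE.
- have nZc w : `| `|Z w| | <= `|e| * (i.+1%:R * c).
    by rewrite normr_id normrM ler_wpM2l.
  have HnZ : H (fun w => `|Z w|).
    apply: (rvs_lipschitz HH ler01 _ HZ) => x y.
    by rewrite mul1r ler_dist_dist.
  have := mean_bounded_fin_num HH HE HnZ nZc.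
  by rewrite fin_numElt => /andP[].
Qed.

(** Reflection only decreases the square, so W_(n+1)^2 is at most
W_n^2 + 2 W_n f(X_n) + f(X_n)^2, whose middle term has nonpositive expectation. *)
Lemma mean_lindley_sqr n (s : R) : mle (fun w => f (X 0%N w)) 0 ->
  mle (fun w => f (X 0%N w) ^+ 2) s -> mle (fun w => W n w ^+ 2) (n%:R * s).
Proof.
move=> f0 fs.
have fsk k : mle (fun w => f (X k w) ^+ 2) s.
  apply: (mean_le_identical (g := fun x => f x * f x) (c := c * c)
    (L := c * L + c * L)) => //.
  - by rewrite addr_ge0// mulr_ge0.
  - by move=> y; rewrite normrM ler_pM.
  - exact: lipschitz_with_mul.
elim: n => [|n IH].
  rewrite mul0r; under eq_fun do rewrite /W/= expr0n; exact: mean_le_cst.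
have m2 := mean_le_scale HH HE (ler0n R 2) (mean_lindley_mul_le0 n f0).
have -> : n.+1%:R * s = n%:R * s + 2 * 0 + s by rewrite -natr1; ring.
apply: mean_le_mono (mean_le_add HH HE (mean_le_add HH HE IH m2) (fsk n)) => //.
  exact: (rvs_sqr HH (rvs_lindley _)).
by move=> w; exact: lindley_sqr_le.
Qed.

End reflected_walk.
End iid_moments.

Section centred_clipped_walk.
Context {R : realType}.
Implicit Types (c m delta s : R) (x : nat -> R).

(** The sign s selects the upper or lower side, and delta compensates the bias
that clipping introduces into the mean. *)
Definition centred c m delta s (y : R) : R := s * (clip c y - m) - delta.

Definition centred_lindley c m delta s x n : R :=
  lindley (fun k => centred c m delta s (x k)) n.

(** The walks control increments over final segments of the block; a partial sum
is the total minus a final segment, hence the factor 2. *)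
Lemma partial_sum_le_lindley c m delta x N n : 0 <= delta ->
  (forall k, (k < N)%N -> `|x k| < c) -> (n <= N)%N ->
  `|\sum_(k < n) x k - n%:R * m| <=
    2 * (centred_lindley c m delta 1 x N + centred_lindley c m delta (-1) x N
         + N%:R * delta).
Proof.
move=> d0 xc nN; set Wp := centred_lindley _ _ _ 1 _ _.
set Wm := centred_lindley _ _ _ (-1) _ _.
have Wp0 : 0 <= Wp by exact: lindley_ge0.
have Wm0 : 0 <= Wm by exact: lindley_ge0.
have block s l : s * \sum_(l <= k < N) (x k - m) <=
    centred_lindley c m delta s x N + N%:R * delta.
  have := sum_le_lindley (fun k => centred c m delta s (x k)) l N.
  rewrite -/(centred_lindley c m delta s x N) => h.
  have -> : s * \sum_(l <= k < N) (x k - m) =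
      \sum_(l <= k < N) centred c m delta s (x k) + (N - l)%:R * delta.
    rewrite mulr_sumr [in RHS]mulr_natl -sumr_const_nat -big_split/=.
    by apply: eq_big_nat => k /andP[_ kN]; rewrite /centred clip_id ?xc// subrK.
  by rewrite lerD// ler_wpM2r// ler_nat leq_subr.
have tail l : `|\sum_(l <= k < N) (x k - m)| <= Wp + Wm + N%:R * delta.
  have := block 1 l; have := block (-1) l; rewrite -/Wp -/Wm ler_norml; lra.
have -> : \sum_(k < n) x k - n%:R * m =
    \sum_(0 <= k < N) (x k - m) - \sum_(n <= k < N) (x k - m).
  rewrite (big_cat_nat _ nN)//= addrK big_mkord sumrB.
  by rewrite sumr_const card_ord mulr_natl.
apply: le_trans (ler_normB _ _) _; have := tail 0%N; have := tail n; lra.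
Qed.

End centred_clipped_walk.

(** * The strong law along dyadic blocks *)

Section dyadic_blocks.
Context {R : realType}.

(** For 2^i <= n the normalisation n^(1/p) is at least b^i. *)
Lemma dyadic_block_cvg0 (p : R) (s e : nat -> R) : 0 < p -> e @ \oo --> 0 ->
  (\forall i \near \oo, forall n, (2 ^ i <= n < 2 ^ i.+1)%N ->
     `|s n| <= dyadic_scale p ^+ i * e i) ->
  s n / n%:R `^ p^-1 @[n --> \oo] --> 0.
Proof.
move=> p0 /cvgr0Pnorm_lt e0 [I _ sI]; apply/cvgr0Pnorm_lt => eps eps0.
have [J _ eJ] := e0 _ eps0.
exists (2 ^ maxn I J)%N => // n /= nIJ.
have n0 : (0 < n)%N by apply: leq_trans nIJ; rewrite expn_gt0.
pose i := trunc_log 2 n.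
have /andP[in1 in2] : (2 ^ i <= n < 2 ^ i.+1)%N by exact: trunc_log_bounds.
have iIJ : (maxn I J <= i)%N by exact: trunc_log_max.
have := sI i (leq_trans (leq_maxl _ _) iIJ) n; rewrite in1 in2 => /(_ isT) sn.
have ei := eJ i (leq_trans (leq_maxr _ _) iIJ); rewrite /= in ei.
have b0 : 0 < dyadic_scale p ^+ i by rewrite exprn_gt0// dyadic_scale_gt0.
have bn : dyadic_scale p ^+ i <= n%:R `^ p^-1.
  rewrite dyadic_scaleX; apply: ge0_ler_powR; rewrite ?nnegrE ?invr_ge0 ?(ltW p0)//.
  by rewrite -natrX ler_nat.
have nd : 0 < (n%:R : R) `^ p^-1 by exact: lt_le_trans bn.
rewrite normrM [`|_^-1|]gtr0_norm ?invr_gt0// ltr_pdivrMr//.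
apply: le_lt_trans sn _; apply: le_lt_trans (_ : dyadic_scale p ^+ i * `|e i| < _).
  by rewrite ler_pM2l// ler_norm.
rewrite mulrC; apply: lt_le_trans (_ : eps * dyadic_scale p ^+ i <= _).
  by rewrite ltr_pM2r.
by rewrite ler_pM2l.
Qed.

(** A term at its cap 1 would by itself make the sum at least 1. *)
Lemma capped_sum_lt1 (c : R) (x : nat -> R) q N k : 0 < c ->
  \sum_(j < N) capped c (x j) ^+ q < 1 -> (k < N)%N -> capped c (x k) < 1.
Proof.
move=> c0 s1 kN; rewrite ltNge; apply: contraTN s1 => ck; rewrite -leNgt.
rewrite (bigD1 (Ordinal kN))//=; apply: le_trans (_ : capped c (x k) ^+ q <= _).
  exact: exprn_ege1.
by rewrite lerDl sumr_ge0// => j _; rewrite exprn_ge0// capped_ge0.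
Qed.

End dyadic_blocks.

Section marcinkiewicz_zygmund.
Context {R : realType} {d : measure_display} {T : measurableType d}.
Variables (H : set (T -> R)) (E : (T -> R) -> \bar R) (X : nat -> T -> R).
Hypotheses (HH : random_variable_space H) (HE : sublinear_expectation H E).
Hypotheses (HX : forall n, H (X n)) (iid : iid_sequence H E X).
Hypothesis Vsub : countably_subadditive (upper_capacity H E).
Local Notation V := (upper_capacity H E).
Local Notation mle := (mean_le H E).

(** The reduction of an almost sure statement to a deterministic one along each
sample point. *)
Lemma almost_surely_cvg0 (xi s : nat -> T -> R) (r : nat -> R) (M : R) :
  (forall i w, 0 <= xi i w) -> (forall i, mle (xi i) (r i)) ->
  (forall n, \sum_(i < n) r i <= M) -> (forall n, H (s n)) ->
  (forall w, xi i w @[i --> \oo] --> (0 : R) ->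
     s n w @[n --> \oo] --> (0 : R)) ->
  almost_surely V (fun w => s n w @[n --> \oo] --> (0 : R)).
Proof.
move=> xi0 xir rM Hs xis; split.
  by apply: measurable_not_cvg0 => n; exact: (rvs_measurable HH).
apply/eqP; rewrite eq_le (capacity_ge0 HH HE) andbT.
rewrite -(borel_cantelli_cvg0 HH HE Vsub xi0 xir rM).
by apply: le_capacity => w /= ns xiw; apply: ns; exact: xis.
Qed.

Lemma rvs_normalized_sum (p m : R) n :
  H (fun w => (partial_sum X n w - n%:R * m) / n%:R `^ p^-1).
Proof.
under eq_fun do rewrite mulrC; apply: (rvs_scale HH).
apply: (rvs_sub HH) (rvs_cst HH _).
exact: (rvs_sum HH _ (F := fun i : 'I_n => X i)).
Qed.

Lemma capped_block_mean (c x : R) q N : 0 < c ->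
  mle (fun w => capped c (X 0%N w) ^+ q) x ->
  mle (fun w => \sum_(k < N) capped c (X k w) ^+ q) (N%:R * x).
Proof.
move=> c0 cx; apply: (mean_le_sum HH HE (F := fun k w => capped c (X k w) ^+ q)).
move=> k; apply: (mean_le_identical HH HE HX iid (g := fun y => capped c y ^+ q)
  (c := 1) (L := q%:R * c^-1)) cx.
- by rewrite mulr_ge0// invr_ge0 ltW.
- by move=> y; rewrite normrX exprn_ile1// norm_capped_le1.
- by apply: lipschitz_with_pow (lipschitz_capped c0) => y; exact: norm_capped_le1.
Qed.

Lemma marcinkiewicz_zygmund_lt1 (p : R) : 0 < p -> p < 1 ->
  (choquet_integral V (fun w => `|X 0%N w| `^ p)%R < +oo)%E ->
  almost_surely V (fun w =>
    partial_sum X n w / n%:R `^ p^-1 @[n --> \oo] --> (0 : R)).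
Proof.
move=> p0 p1 cX; have [xi [u [M [xiu xi0 xi1 sumM]]]] := choquet_tails HH HE p0 cX.
set b := dyadic_scale p in xi1.
have b1 : 1 < b by exact: dyadic_scale_gt1.
have b2 : 2 < b ^+ 1.
  by rewrite expr1 -(@dyadic_scale1 R); exact: dyadic_scale_decreasing.
have bX0 i : 0 < b ^+ i by rewrite exprn_gt0// (lt_trans ltr01).
have [a [M' [a0 aM' aE]]] := capped_moments HH HE b1 (HX 0%N) xiu xi0 xi1 sumM b2.
apply: (almost_surely_cvg0 (r := fun i => 2 * a i) (M := 2 * M')
  (xi := fun i w => \sum_(k < 2 ^ i.+1) capped (b ^+ i) (X k w) ^+ 1)).
- by move=> i w; apply: sumr_ge0 => k _; rewrite exprn_ge0// capped_ge0.
- move=> i; have := capped_block_mean (2 ^ i.+1) (bX0 i) (aE i).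
  congr (mle _ _); rewrite natrX exprS; field.
  by rewrite expf_neq0.
- by move=> n; rewrite -mulr_sumr ler_pM2l.
- move=> n; have := rvs_normalized_sum p 0 n.
  by under eq_fun do rewrite mulr0 subr0.
move=> w xiw; apply: (dyadic_block_cvg0 p0 xiw).
have /cvgr0Pnorm_lt/(_ 1 ltr01)[I _ xiI] := xiw.
exists I => // i /xiI/=; rewrite ltr_norml => /andP[_ xi_lt1] n /andP[_ nN].
apply: le_trans (ler_norm_sum _ _ _) _.
rewrite mulr_sumr (eq_bigr (fun k : 'I_(2 ^ i.+1) => `|X k w|)); last first.
  move=> k _; rewrite expr1 -capped_lt1//.
  exact: (capped_sum_lt1 (x := fun k => X k w) (bX0 i) xi_lt1).
rewrite (big_ord_widen _ (fun k => `|X k w|) (ltnW nN)) big_mkcond/=.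
by apply: ler_sum => k _; case: ifP.
Qed.

(** Two facts about the increment f = s (clip x - m) - delta are needed: its mean
is at most 0, because |x - clip x| is at most the excess, whose mean is at most
delta; and f^2 <= 2 clip^2 + 2 K^2, where clip^2 is c^2 times the squared capped
variable. *)
Lemma centred_lindley_mean (c m delta s K x : R) n :
  0 < c -> 0 <= delta -> `|m| + delta <= K -> `|s| = 1 ->
  mle (fun w => s * (X 0%N w - m)) 0 ->
  mle (fun w => excess c (X 0%N w)) delta ->
  mle (fun w => capped c (X 0%N w) ^+ 2) x ->
  mle (fun w => centred_lindley c m delta s (X ^~ w) n ^+ 2)
    (n%:R * (2 * (c ^+ 2 * x) + 2 * K ^+ 2)).
Proof.
move=> c0 d0 mK s1 sm ex cap.
pose f := centred c m delta s.
have fL : lipschitz_with 1 f.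
  move=> y z; have -> : f y - f z = s * (clip c y - clip c z).
    by rewrite /f /centred; ring.
  by rewrite normrM s1 [leLHS]mul1r; exact: lipschitz_clip.
have fc y : `|f y| <= c + K.
  rewrite /f /centred; apply: le_trans (ler_normB _ _) _.
  rewrite normrM s1 mul1r (ger0_norm d0).
  have := ler_normB (clip c y) m; have := norm_clip_le y c0; lra.
have Hf : H (fun w => f (X 0%N w)) by exact: (rvs_lipschitz HH ler01 fL).
apply: (mean_lindley_sqr HH HE HX iid ler01 fc fL).
- have -> : 0 = 0 + delta + - delta :> R by lra.
  apply: (mean_le_mono HE) (mean_le_add HH HE (mean_le_add HH HE sm ex)
    (mean_le_cst HH HE (- delta))) => // w.
  rewrite /f /centred lerD2r.
  have := ler_norm (s * (clip c (X 0%N w) - X 0%N w)).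
  rewrite normrM s1 mul1r distrC; have := dist_clip_le (X 0%N w) c0; lra.
- have c20 : 0 <= c ^+ 2 by rewrite sqr_ge0.
  apply: (mean_le_mono HE) (mean_le_add HH HE
    (mean_le_scale HH HE (ler0n R 2) (mean_le_scale HH HE c20 cap))
    (mean_le_cst HH HE (2 * K ^+ 2))).
    exact: (rvs_sqr HH).
  move=> w; set y := X 0%N w; rewrite -exprMn -norm_clip// real_normK ?num_real//.
  have -> : f y = s * clip c y - (s * m + delta) by rewrite /f /centred; ring.
  have s2 : s ^+ 2 = 1 by rewrite -real_normK ?num_real// s1 expr1n.
  have BK : (s * m + delta) ^+ 2 <= K ^+ 2.
    rewrite -[leLHS]real_normK ?num_real// lerXn2r ?nnegrE//.
      by apply: le_trans mK; rewrite addr_ge0.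
    apply: le_trans mK; apply: le_trans (ler_normD _ _) _.
    by rewrite normrM s1 mul1r (ger0_norm d0).
  have : 0 <= (s * clip c y + (s * m + delta)) ^+ 2 by exact: sqr_ge0.
  have : (s * clip c y) ^+ 2 = clip c y ^+ 2 by rewrite exprMn s2 mul1r.
  nra.
Qed.

Lemma marcinkiewicz_zygmund_gt1 (p m : R) : 1 < p -> p < 2 ->
  (forall n, E (X n) = m%:E /\ conjugate_expectation E (X n) = m%:E) ->
  ((fun a : R => E (fun w => Num.max (`|X 0%N w| - a) 0)) @ +oo --> 0%E) ->
  (choquet_integral V (fun w => `|X 0%N w| `^ p)%R < +oo)%E ->
  almost_surely V (fun w => (partial_sum X n w - n%:R * m) / n%:R `^ p^-1
    @[n --> \oo] --> (0 : R)).
Proof.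
move=> p1 p2 Em Elim cX; have p0 : 0 < p by exact: lt_trans p1.
have [xi [u [M [xiu xi0 xi1 sumM]]]] := choquet_tails HH HE p0 cX.
set b := dyadic_scale p in xi1.
have b1 : 1 < b by exact: dyadic_scale_gt1.
have b0 : 0 < b by exact: lt_trans b1.
have b2 : b <= 2.
  by rewrite -(@dyadic_scale1 R) ltW//; exact: dyadic_scale_decreasing.
have bb2 : 2 < b ^+ 2.
  rewrite -(@dyadic_scale2 R) ltrXn2r ?nnegrE ?powR_ge0//.
  exact: dyadic_scale_decreasing.
have bX0 i : 0 < b ^+ i by rewrite exprn_gt0.
have [a [M' [a0 aM' aE]]] := capped_moments HH HE b1 (HX 0%N) xiu xi0 xi1 sumM bb2.
have u0 j : 0 <= 2 ^+ j * u j.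
  have [Hxi Exi] := xiu j; rewrite mulr_ge0 ?exprn_ge0// -lee_fin.
  by apply: le_trans Exi; exact: (mean_ge0 HH HE).
have [t [t0 tS tcvg]] := summable_tail u0 sumM.
have exE := mean_excess_le HH HE b1 (HX 0%N) xiu xi0 xi1 b2 t0 tS Elim.
pose delta i := b * (b / 2) ^+ i * t i.
have b21 : 0 <= b / 2 <= 1 by rewrite divr_ge0 ?(ltW b0)//= ler_pdivrMr// mul1r.
have d0 i : 0 <= delta i by rewrite !mulr_ge0// ?exprn_ge0 ?divr_ge0// ltW.
pose K := `|m| + b * t 0%N.
have dK i : `|m| + delta i <= K.
  rewrite lerD2l /delta -mulrA ler_pM2l//.
  have tt0 : t i <= t 0%N.
    elim: i => // i; apply: le_trans; rewrite (tS i) lerDr; exact: u0.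
  case/andP: b21 => b20 b21; apply: le_trans tt0; rewrite ler_piMl//.
  exact: exprn_ile1.
have mean1 : mle (fun w => 1 * (X 0%N w - m)) 0.
  have -> : 0 = m + - m :> R by rewrite subrr.
  have h : mle (X 0%N) m by split=> //; rewrite (Em 0%N).1.
  have := mean_le_add HH HE h (mean_le_cst HH HE (- m)).
  by congr (mle _ _); apply/funext => w; rewrite mul1r.
have meanN1 : mle (fun w => -1 * (X 0%N w - m)) 0.
  have -> : 0 = - m + m :> R by rewrite addrC subrr.
  have h : mle (fun w => - X 0%N w) (- m).
    split; first exact: (rvs_opp HH).
    have := (Em 0%N).2; rewrite /conjugate_expectation => /(congr1 oppe).
    by rewrite oppeK => ->.
  have := mean_le_add HH HE h (mean_le_cst HH HE m).
  by congr (mle _ _); apply/funext => w; rewrite mulN1r opprB addrC.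
pose W s i w := centred_lindley (b ^+ i) m (delta i) s (X ^~ w) (2 ^ i.+1).
have W0 s i w : 0 <= W s i w by exact: lindley_ge0.
have WE s i : `|s| = 1 -> mle (fun w => s * (X 0%N w - m)) 0 ->
    mle (fun w => W s i w ^+ 2) ((2 ^ i.+1)%:R *
      (2 * ((b ^+ i) ^+ 2 * (a i / 2 ^+ i)) + 2 * K ^+ 2)).
  by move=> s1 sm; exact: centred_lindley_mean.
(* The first sum detects truncation and is summable by the capped moments; each
   walk contributes 2^(i+1) b^(-2i) (2 b^(2i) a_i / 2^i + 2 K^2), which is
   4 a_i + 4 K^2 (2 / b^2)^i. *)
pose zeta i w := \sum_(k < 2 ^ i.+1) capped (b ^+ i) (X k w) ^+ 2 +
  ((b ^+ i) ^+ 2)^-1 * (W 1 i w ^+ 2 + W (-1) i w ^+ 2).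
have bi0 i : 0 <= ((b ^+ i) ^+ 2)^-1 by rewrite invr_ge0 sqr_ge0.
have sum0 i w : 0 <= \sum_(k < 2 ^ i.+1) capped (b ^+ i) (X k w) ^+ 2.
  by apply: sumr_ge0 => k _; exact: sqr_ge0.
have Wsum0 i w : 0 <= ((b ^+ i) ^+ 2)^-1 * (W 1 i w ^+ 2 + W (-1) i w ^+ 2).
  by rewrite mulr_ge0// addr_ge0// sqr_ge0.
pose rho := 2 / b ^+ 2.
have rho01 : 0 <= rho < 1.
  by rewrite divr_ge0 ?sqr_ge0//= ltr_pdivrMr ?mul1r ?exprn_gt0.
have rhoM n : \sum_(i < n) rho ^+ i <= (1 + 0) / (1 - rho).
  apply: (summable_recursion (u := fun=> 0) rho01) => //.
  - by move=> i; rewrite exprn_ge0//; case/andP: rho01.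
  - by move=> k; rewrite big1.
  - by move=> i; rewrite addr0 exprS.
apply: (almost_surely_cvg0 (xi := zeta)
  (r := fun i => 10 * a i + 8 * K ^+ 2 * rho ^+ i)
  (M := 10 * M' + 8 * K ^+ 2 * ((1 + 0) / (1 - rho)))).
- by move=> i w; rewrite addr_ge0.
- move=> i; have hN : `|-1 : R| = 1 by rewrite normrN1.
  have := mean_le_add HH HE (capped_block_mean (2 ^ i.+1) (bX0 i) (aE i))
    (mean_le_scale HH HE (bi0 i) (mean_le_add HH HE
      (WE 1 i (normr1 _) mean1) (WE (-1) i hN meanN1))).
  congr (mle _ _); rewrite natrX exprS /rho expr_div_n (exprAC b 2 i).
  by field; rewrite !expf_neq0// gt_eqF.
- move=> n; rewrite big_split/= -!mulr_sumr; apply: lerD.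
    apply: ler_wpM2l; first exact: ler0n. exact: aM'.
  by apply: ler_wpM2l; [rewrite mulr_ge0 ?ler0n ?sqr_ge0|exact: rhoM].
- by move=> n; exact: rvs_normalized_sum.
move=> w zw.
apply: (dyadic_block_cvg0 (e := fun i => 4 * (Num.sqrt (zeta i w) + b * t i)) p0).
  rewrite -(mulr0 (4 : R)); apply: cvgM; first exact: cvg_cst.
  rewrite -[0 in X in _ --> X]addr0; apply: cvgD.
    rewrite -(@sqrtr0 R); apply: continuous_cvg => //; exact: sqrt_continuous.
  rewrite -(mulr0 b); apply: cvgM => //; exact: cvg_cst.
have /cvgr0Pnorm_lt/(_ 1 ltr01)[I _ zI] := zw.
exists I => // i /zI/=; rewrite ltr_norml => /andP[_ z1] n /andP[_ nN].
have Xlt k : (k < 2 ^ i.+1)%N -> `|X k w| < b ^+ i.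
  move=> kN; apply: capped_lt1_norm => //.
  apply: (capped_sum_lt1 (x := fun k => X k w) (q := 2) (bX0 i) _ kN).
  by apply: le_lt_trans z1; rewrite /zeta lerDl.
have Wle s : s = 1 \/ s = -1 -> W s i w <= b ^+ i * Num.sqrt (zeta i w).
  move=> s1; have : W s i w ^+ 2 <= (b ^+ i) ^+ 2 * zeta i w.
    rewrite -ler_pdivrMl ?exprn_gt0// /zeta.
    apply: le_trans (_ : _ <= ((b ^+ i) ^+ 2)^-1 * (W 1 i w ^+ 2 + W (-1) i w ^+ 2)) _.
      by rewrite ler_wpM2l//; case: s1 => ->; rewrite ?lerDl ?lerDr sqr_ge0.
    by rewrite lerDr.
  move=> /ler_wsqrtr; rewrite sqrtr_sqr sqrtrM ?sqr_ge0// sqrtr_sqr.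
  by rewrite (ger0_norm (W0 _ _ _)) gtr0_norm.
apply: le_trans (partial_sum_le_lindley m (d0 i) Xlt (ltnW nN)) _.
rewrite -/(W 1 i w) -/(W (-1) i w).
have -> : (2 ^ i.+1)%:R * delta i = 2 * (b ^+ i * (b * t i)).
  rewrite /delta natrX exprS expr_div_n; field.
  by rewrite expf_neq0.
have := Wle 1 (or_introl erefl); have := Wle (-1) (or_intror erefl).
nra.
Qed.

End marcinkiewicz_zygmund.

Theorem theorem3p2 (R : realType) (d : measure_display) (T : measurableType d)
    (H : set (T -> R)) (E : (T -> R) -> \bar R) (X : nat -> T -> R)
    (H_space : random_variable_space H)
    (E_sublinear : sublinear_expectation H E)
    (X_in_H : forall n, H (X n))
    (X_iid : iid_sequence H E X)
    (V_subadd : countably_subadditive (upper_capacity H E)) :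
  (forall p : R, 0 < p -> p < 1 ->
     (choquet_integral (upper_capacity H E)
        (fun w => `|X 0%N w| `^ p)%R < +oo)%E ->
     almost_surely (upper_capacity H E) (fun w =>
       partial_sum X n w / n%:R `^ p^-1 @[n --> \oo] --> (0 : R)))
  /\
  (forall p mu : R, 1 < p -> p < 2 ->
     (forall n, E (X n) = mu%:E /\ conjugate_expectation E (X n) = mu%:E) ->
     ((fun a : R => E (fun w => Num.max (`|X 0%N w| - a) 0)) @ +oo --> 0%E) ->
     (choquet_integral (upper_capacity H E)
        (fun w => `|X 0%N w| `^ p)%R < +oo)%E ->
     almost_surely (upper_capacity H E) (fun w =>
       (partial_sum X n w - n%:R * mu) / n%:R `^ p^-1
         @[n --> \oo] --> (0 : R))).
Proof.
split=> [p p0 p1|p mu p1 p2 mean excess0]; first exact: marcinkiewicz_zygmund_lt1.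
exact: marcinkiewicz_zygmund_gt1.
Qed.
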